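(* Assume that $M$ is a locally right Garside monoid and $(M_2,M_1)$ is a covering of $M$. Then, for every non-trivial element $x$ of $M$ (i.e., $x\ne1$), there exists a unique decomposition $(x_p,\ldots,x_1)$ of $x$ satisfying $x_p\neq1$ and, for each $r\ge1$ (with $r\le p$), $$x_p\cdots x_{r+1}\perp M_{[r]}\quad\text{and}\quad x_r\in M_{[r]}.$$ The elements $x_r$ are determined from $x^{(0)}=x$ by $$x_r=\mathrm{tail}(x^{(r-1)},M_{[r]})\quad\text{and}\quad x^{(r)}=x^{(r-1)}x_r^{-1}.$$ Moreover, we have $x_r\ne1$ for $r\ge2$ (with $r\le p$).
   Context: For a monoid $M$ and $x,y\in M$: $y$ is a right divisor of $x$, and $x$ is a left multiple of $y$, if $x=zy$ for some $z\in M$; it is a proper right divisor, written $y\prec x$, if $x=zy$ for some $z\neq1$. $\mathrm{Div}_R(x)$ is the set of right divisors of $x$. Left divisors are defined symmetrically. A left lcm of $x,y$ is a common left multiple of $x,y$ that is a right divisor of every common left multiple of $x,y$. $M$ is locally right Garside if: $(C_1)$ $M$ is right cancellative ($xz=yz$ implies $x=y$); $(C_2)$ any two elements of $M$ that admit a common left multiple admit a left lcm; $(C_3)$ for every $x$ in $M$ there is no infinite chain $x_1\prec x_2\prec\cdots$ in $\mathrm{Div}_R(x)$. In such a monoid right divisibility is a partial ordering, and if $y$ is a right divisor of $x$, then $xy^{-1}$ denotes the unique $z$ with $x=zy$. A submonoid $M_1$ of $M$ is closed if every left lcm (in $M$) of elements of $M_1$ belongs to $M_1$ and every left divisor (in $M$)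 of an element of $M_1$ belongs to $M_1$. For such $M_1$ and $x\in M$, $\mathrm{tail}(x,M_1)$ is the unique right divisor of $x$ lying in $M_1$ that is maximal with respect to right divisibility, i.e., the left lcm of $\mathrm{Div}_R(x)\cap M_1$. For $A\subseteq M$, $x\perp A$ means that no non-trivial element of $A$ is a right divisor of $x$. $(M_2,M_1)$ is a covering of $M$ if $M_2,M_1$ are closed submonoids of $M$ and $M_2\cup M_1$ generates $M$ as a monoid. A decomposition of $x$ is a finite sequence $(x_p,\ldots,x_1)$ of elements of $M$ with $x=x_p\cdots x_1$; empty products are $1$. For an integer $r$, $[r]=1$ if $r$ is odd and $[r]=2$ if $r$ is even. *)

(* Defs.v *)
From mathcomp Require Import all_boot.
From mathcomp Require Import boolp classical_sets.

Set Implicit Arguments.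
Unset Strict Implicit.
Unset Printing Implicit Defensive.

Local Open Scope classical_set_scope.
Local Open Scope group_scope.

Section LocallyRightGarside.
Variable M : monoidType.
Implicit Types (x y z l t a : M) (A X : set M) (s : seq M) (r : nat).

Definition DivR x : set M := [set y | exists z, x = z * y].

Definition DivL x : set M := [set y | exists z, x = y * z].

Definition proper_rdiv y x : Prop := exists2 z, z <> 1 & x = z * y.

Definition is_left_lcm_of X l : Prop :=
  (forall y, X y -> DivR l y) /\
  (forall m, (forall y, X y -> DivR m y) -> DivR m l).

Definition is_left_lcm x y : M -> Prop := is_left_lcm_of [set x; y].

Definition right_cancellative : Prop := forall x y z, x * z = y * z -> x = y.

Definition has_left_lcms : Prop := forall x y,
  (exists m, DivR m x /\ DivR m y) -> exists l, is_left_lcm x y l.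

Definition right_noetherian : Prop := forall x,
  ~ exists u : nat -> M,
      forall n, DivR x (u n) /\ proper_rdiv (u n) (u n.+1).

Definition locally_right_garside : Prop :=
  [/\ right_cancellative, has_left_lcms & right_noetherian].

Definition submonoid A : Prop := A 1 /\ forall x y, A x -> A y -> A (x * y).

Definition closed_submonoid A : Prop :=
  [/\ submonoid A,
      forall x y l, A x -> A y -> is_left_lcm x y l -> A l &
      forall x y, A x -> DivL x y -> A y].

(* [smallest submonoid X] is the submonoid generated by [X]. *)
Definition covering (M2 M1 : set M) : Prop :=
  [/\ closed_submonoid M2, closed_submonoid M1 &
      smallest submonoid (M2 `|` M1) = setT].

Definition perp x A : Prop := forall a, A a -> DivR x a -> a = 1.

(* An element of [X] that is a left lcm of [X] is the greatest, hence the only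
   maximal, element of [X] for right divisibility. *)
Definition is_tail x A t : Prop :=
  (DivR x `&` A) t /\ is_left_lcm_of (DivR x `&` A) t.

(* The default value 1 is never used in the cases of interest: see [tailP]
   and [rquoE]. *)
Definition tail x A : M := xget 1 [set t | is_tail x A t].

Definition rquo x y : M := xget 1 [set z | x = z * y].

Definition alternand (M2 M1 : set M) r : set M := if odd r then M1 else M2.

(* A decomposition (x_p, ..., x_1) is the list [:: x_p; ...; x_1], so that
   p = size s, x_r is the item of index p - r (items are numbered from 0 on the
   left), and x_p ... x_(r+1) is the product of the first p - r items. *)
Definition entry s r : M := nth 1 s (size s - r).

Definition upper_prod s r : M := \prod_(y <- take (size s - r) s) y.

Definition decomposition x s : Prop := x = \prod_(y <- s) y.

Definition alternating_decomposition (M2 M1 : set M) x s : Prop :=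
  [/\ decomposition x s,
      entry s (size s) <> 1 &
      forall r, 1 <= r <= size s ->
        perp (upper_prod s r) (alternand M2 M1 r) /\
        alternand M2 M1 r (entry s r)].

(* x^(0) = x and x^(r) = x^(r-1) x_r^-1 where x_r = tail(x^(r-1), M_[r]). *)
Fixpoint remainder (M2 M1 : set M) x r : M :=
  if r is r'.+1 then
    let y := remainder M2 M1 x r' in rquo y (tail y (alternand M2 M1 r))
  else x.

Lemma rquoE x y z : right_cancellative -> x = z * y -> rquo x y = z.
Proof.
move=> canc ->; rewrite /rquo; case: xgetP => [w _ /= /canc ->//|].
by move=> /(_ z) /=.
Qed.

Lemma DivR_antisym x y :
  locally_right_garside -> DivR x y -> DivR y x -> x = y.
Proof.
move=> [canc _ noeth] [z xE] [z' yE].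
have zz' : z' * z = 1.
  by apply: (canc _ _ y); rewrite mul1g -mulgA -xE.
case: (pselect (z = 1)) => [z1|z1]; first by rewrite xE z1 mul1g.
have z'1 : z' <> 1 by move=> e; apply: z1; move: zz'; rewrite e mul1g.
case: (noeth 1); exists (fun n => if odd n then z else 1) => n /=.
case: (odd n) => /=; split.
- by exists z'.
- by exists z'.
- by exists 1; rewrite mulg1.
- by exists z => //; rewrite mulg1.
Qed.

Lemma tailP x A :
  locally_right_garside -> closed_submonoid A -> is_tail x A (tail x A).
Proof.
move=> [canc lcms noeth] [[A1 _] Alcm _].
suff [t tP] : exists t, is_tail x A t by rewrite /tail; exact: (xgetPex 1 (ex_intro _ t tP)).
apply: contrapT => /forallNP notail.
have step (t : M) : exists t', (DivR x `&` A) t ->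
    (DivR x `&` A) t' /\ proper_rdiv t t'.
  case: (pselect ((DivR x `&` A) t)) => [Dt|]; last by exists t.
  have [y [Dy yt]] : exists y, (DivR x `&` A) y /\ ~ DivR t y.
    apply: contrapT => /forallNP all; apply: (notail t); split=> //; split.
      by move=> y Dy; apply: contrapT => yt; apply: (all y).
    by move=> m; apply.
  have [l lP] : exists l, is_left_lcm t y l.
    by apply: lcms; exists x; split; [case: Dt|case: Dy].
  exists l => _; split.
    split; last by apply: Alcm lP; [case: Dt|case: Dy].
    by case: lP => _; apply=> w [|] ->; [case: Dt|case: Dy].
  have [up _] := lP; have [z lE] := up t (or_introl erefl).
  exists z => // z1; apply: yt.
  by have := up y (or_intror erefl); rewrite lE z1 mul1g.
have [f fP] := choice step.
apply: (noeth x); exists (fun n => iter n f 1).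
have D n : (DivR x `&` A) (iter n f 1).
  elim: n => [|n /fP []//]; split=> //.
  by exists x; rewrite mulg1.
by move=> n; split; [case: (D n)|case: (fP _ (D n))].
Qed.

End LocallyRightGarside.

(* Main.v *)
Require Import Defs.
From mathcomp Require Import all_boot boolp classical_sets.

(** Peeling off tails alternately in [M1] and [M2] produces right divisors
    [x_r ... x_1] of [x].  What remains after removing a tail in [M_[r]] is
    orthogonal to [M_[r]]; so if the next tail is trivial, the remainder is
    orthogonal to both submonoids, hence is 1 because they generate [M].  By
    noetherianity the remainder therefore reaches 1, and the first time this
    happens gives the decomposition.  Conversely, orthogonality of
    [x_p ... x_(r+1)] to [M_[r]] forces [x_r] to be the tail of
    [x_p ... x_r], and [x_p <> 1] forces [p] to be the first such time. *)

Section AlternatingDecomposition.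
Local Open Scope group_scope.
Set Implicit Arguments.
Unset Strict Implicit.

Variable M : monoidType.
Hypothesis hM : locally_right_garside M.
Implicit Types (x y z t a : M) (A : set M) (s : seq M).

(** [y] and 1 right-divide each other, so antisymmetry applies; [M] has no non-trivial units. *)
Lemma mulg_eq1r x y : x * y = 1 -> y = 1.
Proof.
move=> xy1; apply: DivR_antisym => //; first by exists y; rewrite mulg1.
by exists x.
Qed.

Lemma mulg_eq1l x y : x * y = 1 -> x = 1.
Proof. by move=> xy1; move: (xy1); rewrite (mulg_eq1r xy1) mulg1. Qed.

Lemma rquo_tailK x A :
  closed_submonoid A -> x = rquo x (tail x A) * tail x A.
Proof.
move=> cA; have [[[z xE] _] _] := tailP x hM cA.
by have [canc _ _] := hM; rewrite (rquoE canc xE).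
Qed.

(** If [a] in [A] right-divides the quotient, then [a * tail x A] is a right divisor of [x] in [A],
    hence of the tail; cancelling the tail makes [a] a factor of 1. *)
Lemma perp_rquo_tail x A :
  closed_submonoid A -> perp (rquo x (tail x A)) A.
Proof.
move=> cA a Aa [z qE]; have [[_ At] [ub _]] := tailP x hM cA.
have [[_ AM] _ _] := cA.
have [|w tE] := ub (a * tail x A).
  by split; [exists z; rewrite mulgA -qE; exact: rquo_tailK|exact: AM].
have [canc _ _] := hM; apply: (@mulg_eq1r w).
by apply: (canc _ _ (tail x A)); rewrite mul1g -mulgA -tE.
Qed.

(** The tail is [z * t] for some [z], which lies in [A] by closure under left divisors. Cancelling
    [t] makes [z] a right divisor of [y], so [z = 1]. *)
Lemma tail_of_perp y t A :
  closed_submonoid A -> A t -> perp y A -> tail (y * t) A = t.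
Proof.
move=> cA At py; have [[[w ytE] At'] [ub _]] := tailP (y * t) hM cA.
have [|z tE] := ub t; first by split=> //; exists y.
have [_ _ AL] := cA; have [canc _ _] := hM.
have Az : A z by apply: AL At' _; exists t.
rewrite tE (py z Az) ?mul1g//; exists w.
by apply: (canc _ _ t); rewrite -mulgA -tE.
Qed.

Variables M2 M1 : set M.
Hypothesis hcov : covering M2 M1.

Lemma closed_alternand r : closed_submonoid (alternand M2 M1 r).
Proof. by have [c2 c1 _] := hcov; rewrite /alternand; case: odd. Qed.
Hint Resolve closed_alternand : core.

Lemma perp_cover_eq1 x : perp x M2 -> perp x M1 -> x = 1.
Proof.
have [_ _ gen] := hcov.
(* [P] defines a submonoid: right divisors of [z] right-divide [y * z], so orthogonality of [y * z]
   first gives [z = 1], then [y = 1]. *)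
pose P (y : M) := perp y (M2 `|` M1)%classic -> y = 1.
suff Px : P x by move=> p2 p1; apply: Px => a [/p2|/p1]; exact.
have: (smallest (@submonoid M) (M2 `|` M1)%classic) x by rewrite gen.
apply; split=> [|y My py]; last by apply: py => //; exists 1; rewrite mul1g.
split=> [//|y z Py Pz pyz].
have z1 : z = 1.
  by apply: Pz => a Aa [w zE]; apply: pyz => //; exists (y * w); rewrite zE mulgA.
by move: pyz; rewrite z1 mulg1.
Qed.

Lemma perp_alternands_eq1 x r :
  perp x (alternand M2 M1 r) -> perp x (alternand M2 M1 r.+1) -> x = 1.
Proof.
by rewrite /alternand /=; case: odd => pa pb; apply: perp_cover_eq1.
Qed.

Lemma upper_prod0 s : upper_prod s 0 = \prod_(y <- s) y.
Proof. by rewrite /upper_prod subn0 take_size. Qed.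

Lemma upper_prod_size s : upper_prod s (size s) = 1.
Proof. by rewrite /upper_prod subnn take0 big_nil. Qed.

Lemma upper_prodS s r :
  r < size s -> upper_prod s r = upper_prod s r.+1 * entry s r.+1.
Proof.
move=> rs; rewrite /upper_prod /entry -(subnSK rs) (take_nth 1).
  by rewrite big_rcons.
by rewrite subnSK // leq_subr.
Qed.

Section Remainders.
Variable x : M.
Let R r := remainder M2 M1 x r.
Let T r := tail (R r.-1) (alternand M2 M1 r).

Lemma remainderE r : R r = R r.+1 * T r.+1.
Proof. exact: rquo_tailK. Qed.

Lemma perp_remainder r : 0 < r -> perp (R r) (alternand M2 M1 r).
Proof. by case: r => // r _; exact: perp_rquo_tail. Qed.

(** The case [r = 1] is excluded because [R 0 = x] need not be orthogonal to [M2]: x_1 may be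
    trivial. *)
Lemma tail_eq1_remainder r : 1 < r -> T r = 1 -> R r.-1 = 1.
Proof.
case: r => [|[|r]] // _ T1; apply: (@perp_alternands_eq1 _ r.+1).
  exact: perp_remainder.
have -> : R r.+2.-1 = R r.+2 by rewrite /= (remainderE r.+1) T1 mulg1.
exact: perp_remainder.
Qed.

Lemma remainder_eventually1 : exists n, R n = 1.
Proof.
apply: contrapT => /forallNP R1; have [_ _ noeth] := hM; apply: (noeth x).
(* [u n] is x_(n+1) ... x_1; starting at x_1 makes each later factor a [T r] with [r >= 2], hence
   non-trivial. *)
pose u := fix u n := if n is n'.+1 then T n.+1 * u n' else T 1.
have xE n : x = R n.+1 * u n.
  elim: n => [|n IHn] /=; first exact: (remainderE 0).
  by rewrite mulgA -remainderE.
exists u => n; split; first by exists (R n.+1).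
by exists (T n.+2) => // /tail_eq1_remainder => /(_ isT); exact: R1.
Qed.

Lemma alternating_decomposition_upper_prod s r :
  alternating_decomposition M2 M1 x s -> r <= size s -> upper_prod s r = R r.
Proof.
move=> [xE _ alt]; elim: r => [|r IHr] rs; first by rewrite upper_prod0.
have [pr Ar] := alt r.+1 rs; have [canc _ _] := hM.
rewrite /R /= -/(R r) -IHr ?(ltnW rs) //; apply/esym/rquoE => //.
by rewrite upper_prodS // tail_of_perp.
Qed.

Lemma alternating_decomposition_entry s r :
  alternating_decomposition M2 M1 x s -> 0 < r <= size s -> entry s r = T r.
Proof.
case: r => // r sP rs; have [_ _ alt] := sP; have [pr Ar] := alt r.+1 rs.
rewrite /T /= -(alternating_decomposition_upper_prod sP (ltnW rs)).
by rewrite upper_prodS // tail_of_perp.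
Qed.

Lemma alternating_decomposition_remainder_size s :
  alternating_decomposition M2 M1 x s -> R (size s) = 1.
Proof.
by move=> sP; rewrite -(alternating_decomposition_upper_prod sP) ?upper_prod_size.
Qed.

Lemma alternating_decomposition_remainder_neq1 s r :
  alternating_decomposition M2 M1 x s -> r < size s -> R r <> 1.
Proof.
move=> sP rs; have [_ s1 _] := sP.
rewrite -(alternating_decomposition_upper_prod sP (ltnW rs)).
move: rs s1; rewrite /upper_prod /entry subnn => rs s1.
case: s rs s1 {sP} => //= y s rs y1.
(* Since [r < size s], the product starts with x_p, so it cannot be 1. *)
by rewrite subSn //= big_cons => /mulg_eq1l.
Qed.

Lemma alternating_decomposition_size_le s s' :
  alternating_decomposition M2 M1 x s -> alternating_decomposition M2 M1 x s' ->
  size s <= size s'.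
Proof.
move=> sP s'P; rewrite leqNgt; apply/negP => lt.
apply: (alternating_decomposition_remainder_neq1 sP lt).
exact: alternating_decomposition_remainder_size.
Qed.

Lemma alternating_decomposition_uniq s s' :
  alternating_decomposition M2 M1 x s -> alternating_decomposition M2 M1 x s' ->
  s = s'.
Proof.
move=> sP s'P; have szE : size s = size s'.
  by apply/eqP; rewrite eqn_leq !alternating_decomposition_size_le.
apply: (@eq_from_nth _ 1) => // i i_s.
have nthE u : size u = size s -> nth 1 u i = entry u (size s - i).
  by move=> uE; rewrite /entry uE subKn // ltnW.
have si : 0 < size s - i <= size s by rewrite subn_gt0 i_s leq_subr.
by rewrite !nthE // !alternating_decomposition_entry -?szE.
Qed.

Lemma alternating_decomposition_exists :
  x <> 1 -> exists s, alternating_decomposition M2 M1 x s.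
Proof.
move=> x1; have [n Rn] := remainder_eventually1.
have exR : exists n, `[< R n = 1 >] by exists n; apply/asboolP.
case: (ex_minnP exR) => p /asboolP Rp minp {n Rn exR}.
have R1 r : r < p -> R r <> 1.
  by move=> rp Rr; move: rp; rewrite ltnNge minp //; apply/asboolP.
have p0 : 0 < p by case: p Rp {minp R1} => // /x1.
(* Lists start with x_p, so item [i] is x_(p-i). *)
pose s := mkseq (fun i => T (p - i)) p; exists s.
have szs : size s = p by rewrite size_mkseq.
have entryE r : 0 < r <= p -> entry s r = T r.
  case/andP=> r0 rp; rewrite /entry szs nth_mkseq ?subKn //.
  by rewrite ltn_subrL r0 p0.
have upperE r : r <= p -> upper_prod s r = R r.
  (* Descending induction from [r = p], where both sides are 1. *)
  move=> rp; rewrite -(subKn rp); elim: (p - r) (leq_subr r p) => [|k IHk] kp.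
    by rewrite subn0 -{1}szs upper_prod_size Rp.
  have lt : p - k.+1 < p by rewrite ltn_subrL p0.
  rewrite upper_prodS ?szs // subnSK // IHk ?(ltnW kp) // entryE.
    by rewrite [RHS]remainderE subnSK.
  by rewrite subn_gt0 kp leq_subr.
split=> [||r]; rewrite ?szs.
- by rewrite /decomposition -upper_prod0 upperE.
(* A trivial x_p would give [R p.-1 = R p = 1], against minimality of [p]; this also covers
   [p = 1]. *)
- rewrite entryE ?p0 ?leqnn // => Tp; apply: (@R1 p.-1); first by rewrite prednK.
  by rewrite remainderE prednK // Tp Rp mulg1.
case/andP=> r0 rp; rewrite upperE // entryE ?r0 //; split.
  exact: perp_remainder.
by have [[_ ?] _] := tailP (R r.-1) hM (closed_alternand r).
Qed.

End Remainders.
End AlternatingDecomposition.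

Theorem proposition1p16 (M : monoidType) (M2 M1 : set M)
    (hM : locally_right_garside M) (hcov : covering M2 M1)
    (x : M) (hx : x <> 1%g) :
  (exists! s : seq M, alternating_decomposition M2 M1 x s) /\
  (forall s : seq M, alternating_decomposition M2 M1 x s ->
    (forall r : nat, 1 <= r <= size s ->
      entry s r = tail (remainder M2 M1 x r.-1) (alternand M2 M1 r)
      /\ remainder M2 M1 x r
         = rquo (remainder M2 M1 x r.-1) (entry s r)) /\
    (forall r : nat, 2 <= r <= size s -> entry s r <> 1%g)).
Proof.
split.
  have [s sP] := alternating_decomposition_exists hM hcov hx.
  by exists s; split=> // s'; apply: alternating_decomposition_uniq.
move=> s sP; have entryE r : 1 <= r <= size s ->
    entry s r = tail (remainder M2 M1 x r.-1) (alternand M2 M1 r).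
  exact: (alternating_decomposition_entry hM hcov sP).
split=> r /andP[r1 rs].
  by rewrite entryE ?r1 //; split=> //; case: r r1 {rs}.
rewrite entryE ?(ltnW r1) // => /(tail_eq1_remainder hM hcov r1).
by apply: (alternating_decomposition_remainder_neq1 hM hcov sP); case: r r1 rs.
Qed.
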